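(* Let $\mathcal{Q}$ be a smooth manifold, let $H$ be a smooth real-valued function on $\mathcal{T}^*\mathcal{Q}=T^*\mathcal{Q}\times\mathbb{R}$ with evolution vector field $\varepsilon_H$, let $W=W(q)$ be a smooth function on $\mathcal{Q}$ with first prolongation $\mathcal{T}^*W:\mathcal{Q}\to\mathcal{T}^*\mathcal{Q}$, and define the vector field $\varepsilon_H^{\mathcal{T}^*W}:=T\pi^0_{\mathcal{Q}}\circ\varepsilon_H\circ\mathcal{T}^*W$ on $\mathcal{Q}$. Then the following conditions are equivalent: 1. The vector fields $\varepsilon_H$ and $\varepsilon_H^{\mathcal{T}^*W}$ are $\mathcal{T}^*W$-related, that is, $T\mathcal{T}^*W\circ\varepsilon_H^{\mathcal{T}^*W}=\varepsilon_H\circ\mathcal{T}^*W$, where $T\mathcal{T}^*W:T\mathcal{Q}\to T\mathcal{T}^*\mathcal{Q}$ is the tangent map of $\mathcal{T}^*W$. 2. The equation $d(H\circ\mathcal{T}^*W)=0$ holds.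
   Context: The extended cotangent bundle $\mathcal{T}^*\mathcal{Q}=T^*\mathcal{Q}\times\mathbb{R}$ carries the contact form $\eta_{\mathcal{Q}}=dz-\theta_{\mathcal{Q}}$, with $\theta_{\mathcal{Q}}$ the canonical one-form of $T^*\mathcal{Q}$ and $z$ the coordinate on $\mathbb{R}$; in Darboux coordinates $(q^i,p_i,z)$, $\eta_{\mathcal{Q}}=dz-p_i\,dq^i$, and the Reeb field is $\mathcal{R}=\partial/\partial z$. The evolution vector field $\varepsilon_H$ of $H$ is the vector field on $\mathcal{T}^*\mathcal{Q}$ determined by $$\mathcal{L}_{\varepsilon_H}\eta_{\mathcal{Q}}=dH-\mathcal{R}(H)\,\eta_{\mathcal{Q}},\qquad \eta_{\mathcal{Q}}(\varepsilon_H)=0,$$ i.e. in coordinates $\varepsilon_H=\frac{\partial H}{\partial p_i}\frac{\partial}{\partial q^i}-\big(\frac{\partial H}{\partial q^i}+p_i\frac{\partial H}{\partial z}\big)\frac{\partial}{\partial p_i}+p_i\frac{\partial H}{\partial p_i}\frac{\partial}{\partial z}$. The projection $\pi^0_{\mathcal{Q}}:\mathcal{T}^*\mathcal{Q}\to\mathcal{Q}$ is $(\zeta,z)\mapsto\pi_{\mathcal{Q}}(\zeta)$, with $\pi_{\mathcal{Q}}$ the cotangent projection. The first prolongation of $W$ is the section $\mathcal{T}^*W:\mathcal{Q}\to T^*\mathcal{Q}\times\mathbb{R}$, $q\mapsto(dW(q),W(q))$, i.e. $(q^i)\mapsto(q^i,\partial W/\partial q^i,W(q))$. *)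

(* Defs.v *)
From mathcomp Require Import all_boot all_order all_algebra.
From mathcomp Require Import all_classical all_reals all_analysis.

Set Implicit Arguments.
Unset Strict Implicit.
Unset Printing Implicit Defensive.

Import Order.TTheory GRing.Theory Num.Theory.
Import numFieldNormedType.Exports.

Local Open Scope classical_set_scope.
Local Open Scope ring_scope.

(* Only meant for U open and E finite-dimensional, where the continuity of all
   the 'D_v f amounts to that of 'd f.                                        *)
Fixpoint Ck (R : realType) (E F : normedModType R) (k : nat) (U : set E)
    (f : E -> F) : Prop :=
  if k is k'.+1 then
    (forall x, U x -> differentiable f x) /\ forall v, Ck k' U ('D_v f)
  else forall x, U x -> {for x, continuous f}.

Definition smooth_on (R : realType) (E F : normedModType R) (U : set E)
  (f : E -> F) : Prop := forall k, Ck k U f.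

(* A partial bijection between M and E; [cinv] is only meaningful on the image
   of [cdom], and [cmap] on [cdom].                                           *)
Record chart (R : realType) (E : normedModType R) (M : Type) := Chart {
  cdom : set M;
  cmap : M -> E;
  cinv : E -> M }.

(* A set with an atlas modelled on E, together with the choice of a preferred
   chart around each point. The tangent space at p is the model space E, a
   vector being represented by its components in the preferred chart at p;
   components in other charts are obtained with [vec_to_chart]. No axioms are
   imposed here: see [smooth_manifold] for those of a base manifold, from which
   those of [ext_cotangent] follow.                                           *)
Record charted (R : realType) (E : normedModType R) := Charted {
  point :> Type;
  atlas : set (chart E point);
  chart_at : point -> chart E point }.

Arguments atlas {R E} M : rename.

Section Charted.
Context {R : realType}.
Implicit Types E F : normedModType R.

Definition cimage E (M : charted E) (a : chart E M) : set E := cmap a @` cdom a.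

Definition tangent E (M : charted E) (p : M) : Type := E.

(* The components in the chart a of the tangent vector v at p, and conversely
   the tangent vector at p with components e in the chart a.                  *)
Definition vec_to_chart E (M : charted E) (a : chart E M) (p : M)
    (v : tangent p) : E :=
  'd (cmap a \o cinv (chart_at p)) (cmap (chart_at p) p) v.

Definition vec_of_chart E (M : charted E) (a : chart E M) (p : M) (e : E) :
    tangent p :=
  'd (cmap (chart_at p) \o cinv a) (cmap a p) e.

Definition tangent_map E F (M : charted E) (N : charted F) (f : M -> N) (p : M)
    (v : tangent p) : tangent (f p) :=
  'd (cmap (chart_at (f p)) \o f \o cinv (chart_at p)) (cmap (chart_at p) p) v.

Definition smooth_fun E (M : charted E) (f : M -> R) : Prop :=
  forall a, atlas M a -> smooth_on (cimage a) (f \o cinv a).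

Definition differential E (M : charted E) (f : M -> R) (p : M)
    (v : tangent p) : R :=
  'd (f \o cinv (chart_at p)) (cmap (chart_at p) p) v.

Definition vector_field E (M : charted E) : Type := forall p : M, tangent p.

(* Linearity on each tangent space is not bundled: it holds for [eta], the only
   one-form to which [lie_derivative] is applied.                             *)
Definition one_form E (M : charted E) : Type := forall p : M, tangent p -> R.

Definition vf_in_chart E (M : charted E) (X : vector_field M) (a : chart E M)
    (x : E) : E :=
  vec_to_chart a (X (cinv a x)).

Definition form_in_chart E (M : charted E) (w : one_form M) (a : chart E M)
    (x : E) (e : E) : R :=
  w (cinv a x) (vec_of_chart a (cinv a x) e).

Definition smooth_vector_field E (M : charted E) (X : vector_field M) : Prop :=
  forall a, atlas M a -> smooth_on (cimage a) (vf_in_chart X a).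

(* In a chart, (L_X w)_j = X^i d_i w_j + w_i d_j X^i.                         *)
Definition lie_derivative E (M : charted E) (X : vector_field M)
    (w : one_form M) : one_form M :=
  fun p v =>
  let a := chart_at p in
  let x := cmap a p in
  'D_(vf_in_chart X a x) (fun y => form_in_chart w a y v) x
  + form_in_chart w a x ('D_v (vf_in_chart X a) x).

End Charted.

Record smooth_manifold (R : realType) (n : nat) := SmoothManifold {
  mspace : topologicalType;
  matlas : set (chart 'rV[R]_n mspace);
  mchart_at : mspace -> chart 'rV[R]_n mspace;
  mspace_hausdorff : hausdorff_space mspace;
  mspace_second_countable : @second_countable mspace;
  mchart_at_atlas : forall p, matlas (mchart_at p);
  mchart_at_dom : forall p, cdom (mchart_at p) p;
  mchart_open_dom : forall a, matlas a -> open (cdom a);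
  mchart_open_image : forall a, matlas a -> open (cmap a @` cdom a);
  mchartK : forall a, matlas a -> forall p, cdom a p -> cinv a (cmap a p) = p;
  mchart_continuous : forall a, matlas a ->
    forall p, cdom a p -> {for p, continuous (cmap a)};
  mchart_inv_continuous : forall a, matlas a ->
    forall p, cdom a p -> {for cmap a p, continuous (cinv a)};
  mchart_transition : forall a b, matlas a -> matlas b ->
    smooth_on (cmap a @` (cdom a `&` cdom b)) (cmap b \o cinv a) }.

Definition charted_of_manifold (R : realType) (n : nat)
    (Q : smooth_manifold R n) : charted 'rV[R]_n :=
  Charted (@matlas R n Q) (@mchart_at R n Q).

Coercion charted_of_manifold : smooth_manifold >-> charted.

Section ExtendedCotangent.
Context {R : realType} {n : nat}.
Variable Q : smooth_manifold R n.

Definition cotangent (q : Q) : Type := 'Hom(tangent q, R^o).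

Definition dW_at (W : Q -> R) (q : Q) : cotangent q :=
  linfun (differential W (p := q) : 'rV[R]_n -> R^o).

Definition ext_cotangent_point : Type := {q : Q & cotangent q} * R.

(* The Darboux chart (q^i, p_i, z) induced by a chart (q^i) of Q, where
   p_i = zeta (d/dq^i) and zeta = p_i dq^i.                                   *)
Definition darboux_chart (a : chart 'rV[R]_n Q) :
    chart ('rV[R]_n * 'rV[R]_n * R)%type ext_cotangent_point :=
  Chart
    [set u : ext_cotangent_point | cdom a (projT1 u.1)]
    (fun u : ext_cotangent_point =>
       (cmap a (projT1 u.1),
        \row_i (projT2 u.1 (vec_of_chart a (projT1 u.1) (delta_mx 0 i)) : R),
        u.2))
    (fun x =>
       (existT cotangent (cinv a x.1.1)
          (linfun (fun v : 'rV[R]_n =>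
             (\sum_i x.1.2 0 i * vec_to_chart (p := cinv a x.1.1) a v 0 i) : R^o)),
        x.2)).

Definition ext_cotangent : charted ('rV[R]_n * 'rV[R]_n * R)%type :=
  @Charted R _ ext_cotangent_point
    (darboux_chart @` atlas Q)
    (fun u => darboux_chart (chart_at (projT1 u.1))).

Definition pi0 (u : ext_cotangent) : Q := projT1 u.1.

Definition coord_z (u : ext_cotangent) : R := u.2.

Definition theta : one_form ext_cotangent :=
  fun u v => projT2 u.1 (tangent_map pi0 v).

Definition eta : one_form ext_cotangent :=
  fun u v => differential coord_z v - theta v.

(* The Reeb field d/dz: (0, 0, 1) are its components in any Darboux chart, in
   particular in the preferred chart at u.                                    *)
Definition reeb : vector_field ext_cotangent := fun u => (0, 0, 1).

Definition is_evolution_field (H : ext_cotangent -> R)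
    (X : vector_field ext_cotangent) : Prop :=
  [/\ smooth_vector_field X,
      forall (u : ext_cotangent) (v : tangent u),
        lie_derivative X eta v
        = differential H v - differential H (reeb u) * eta v
    & forall u : ext_cotangent, eta (X u) = 0].

Definition first_prolongation (W : Q -> R) : Q -> ext_cotangent :=
  fun q => (existT cotangent q (dW_at W q), W q).

Definition reduced_field (X : vector_field ext_cotangent) (W : Q -> R) :
    vector_field Q :=
  fun q => tangent_map pi0 (X (first_prolongation W q)).

End ExtendedCotangent.

Definition related (R : realType) (E F : normedModType R) (M : charted E)
    (N : charted F) (f : M -> N) (X : vector_field M) (Y : vector_field N) :
    Prop :=
  forall p : M, tangent_map f (X p) = Y (f p).

(* Main.v *)
(** Work in the Darboux chart induced by a chart of [Q]: there
    [eta = dz - p_i dq^i]. Differentiating [eta eps = 0] along [v] removes the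
    derivatives of [eps] from Cartan's expression, leaving
    [(L_eps eta) v = eps_q^i v_{p_i} - eps_{p_i} v_q^i]. The tangent vectors of
    the prolongation of [W] are annihilated by [eta], so the evolution equation
    evaluated on them gives, the Hessian of [W] being symmetric,
    [d(H o T*W) v = (D_{eps_q} d_i W - eps_{p_i}) v^i].
    The coefficient of [v^i] is the [p_i]-component of the defect of
    relatedness; its [q]-components vanish by definition of the reduced field,
    and its [z]-component because [eta eps = 0]. *)
From HB Require Import structures.
Require Import Defs.
From mathcomp Require Import all_boot all_order all_algebra.
From mathcomp Require Import all_classical all_reals all_analysis.
Import Order.TTheory GRing.Theory Num.Theory.
Import numFieldNormedType.Exports.

Set Implicit Arguments.
Unset Strict Implicit.
Unset Printing Implicit Defensive.

Local Open Scope classical_set_scope.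
Local Open Scope ring_scope.

(** * Differential calculus: locality, mean value theorem, symmetry of second derivatives *)

Section Differentials.
Context {R : realType}.
Implicit Types U V W : normedModType R.

(** The first-order expansion of [g] at [x] is also one of [f], since a little-o only sees a
    neighbourhood. Chart expressions are known in closed form only near a point, so most
    differentials below are computed through this. *)
Lemma near_eq_is_diff V W (f g : V -> W) (x : V) :
  (\forall y \near x, f y = g y) -> differentiable g x ->
  is_diff x f ('d g x).
Proof.
move=> fg dg.
have fgx : f x = g x := nbhs_singleton fg.
have E : f \o shift x = cst (f x) + 'd g x +o_ 0 id.
  apply/eqaddoP => e e0.
  have /eqaddoP/(_ _ e0) dgo := diff_locally dg.
  move: fg; rewrite (near_shift 0) subr0 => fg.
  apply: filterS2 fg dgo => h /= fgh.
  by rewrite !fctE /= -fgx -fgh.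
have D : 'd f x = 'd g x :> (V -> W).
  by apply: diff_unique => //; exact: diff_continuous.
split => //; apply/diff_locallyP; rewrite D; split => //.
exact: diff_continuous.
Qed.

Lemma near_eq_differentiable V W (f g : V -> W) (x : V) :
  (\forall y \near x, f y = g y) -> differentiable g x -> differentiable f x.
Proof. by move=> fg dg; have [] := near_eq_is_diff fg dg. Qed.

Lemma near_eq_diff V W (f g : V -> W) (x : V) :
  (\forall y \near x, f y = g y) -> differentiable g x ->
  'd f x = 'd g x :> (V -> W).
Proof. by move=> fg dg; have [] := near_eq_is_diff fg dg. Qed.

Lemma differentiable_fst V W (x : V * W) : differentiable (fst : V * W -> V) x.
Proof. by apply: linear_differentiable => y; exact: cvg_fst. Qed.

Lemma differentiable_snd V W (x : V * W) : differentiable (snd : V * W -> W) x.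
Proof. by apply: linear_differentiable => y; exact: cvg_snd. Qed.

Lemma diff_fst V W (x : V * W) : 'd (fst : V * W -> V) x = fst :> (V * W -> V).
Proof. by apply: diff_lin => y; exact: cvg_fst. Qed.

Lemma diff_snd V W (x : V * W) : 'd (snd : V * W -> W) x = snd :> (V * W -> W).
Proof. by apply: diff_lin => y; exact: cvg_snd. Qed.

Lemma differentiable_mx V m n (M : V -> 'M[R]_(m, n)) (x : V) :
  (forall i j, differentiable (fun y => M y i j : R) x) -> differentiable M x.
Proof.
move=> dM.
pose mk i j : R -> 'M[R]_(m, n) := fun a => a *: delta_mx i j.
have -> : M = \sum_(i < m) \sum_(j < n) (mk i j \o (fun y => M y i j)).
  apply/funext => y; rewrite {1}[M y]matrix_sum_delta fct_sumE.
  by apply: eq_bigr => i _; rewrite fct_sumE.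
do 2! apply: differentiable_sum => ?.
by apply: differentiable_comp => //.
Qed.

(** One-variable mean value theorem for [f] restricted to the segment [s |-> y + s *: w]. *)
Lemma MVT_line V (f : V -> R) (y w : V) (h : R) : 0 < h ->
  (forall s : R, 0 <= s <= h -> differentiable f (y + s *: w)) ->
  exists2 c, 0 <= c <= h & f (y + h *: w) - f y = h * 'D_w f (y + c *: w).
Proof.
move=> h0 df.
pose l (s : R) : V := y + s *: w.
have dl (s : R) : is_diff s l ( *:%R^~ w).
  rewrite (_ : l = cst y + *:%R^~ w) //.
  by apply: is_diff_eq; rewrite add0r.
have dfl s : 0 <= s <= h -> differentiable (f \o l) s.
  by move=> sh; apply: differentiable_comp => //; exact: df.
have [s||c ch] := @MVT R (f \o l) (fun s => 'D_w f (l s)) 0 h h0.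
- rewrite in_itv /= => /andP[/ltW s0 /ltW sh].
  have shh : 0 <= s <= h by rewrite s0.
  apply: DeriveDef; first exact/diff_derivable/dfl.
  rewrite deriveE; last exact: dfl.
  rewrite diff_comp //; last exact: df.
  by rewrite /= diff_val scale1r deriveE //; exact: df.
- apply: derivable_within_continuous => s; rewrite in_itv /= => sh.
  exact/diff_derivable/dfl.
rewrite /l /= scale0r addr0 subr0 mulrC => E; exists c => //.
by move: ch; rewrite in_itv /= => /andP[/ltW -> /ltW ->].
Qed.

(** The mean value theorem is used twice: along [u] for the increment [F y = f (y + h *: v) - f y],
    then along [v] for the derivative ['D_u f] that this produces. *)
Lemma second_difference V (f : V -> R) (x u v : V) (h : R) : 0 < h ->
  (forall s t : R, 0 <= s <= h -> 0 <= t <= h ->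
    differentiable f (x + s *: u + t *: v) /\
    differentiable ('D_u f) (x + s *: u + t *: v)) ->
  exists s t : R, [/\ 0 <= s <= h, 0 <= t <= h &
    f (x + h *: u + h *: v) - f (x + h *: u) - (f (x + h *: v) - f x)
    = h * (h * 'D_v ('D_u f) (x + s *: u + t *: v))].
Proof.
move=> h0 df.
have h00 : 0 <= (0 : R) <= h by rewrite lexx ltW.
have hhh : 0 <= h <= h by rewrite lexx ltW.
pose F y := f (y + h *: v) - f y.
have dT y : is_diff y (fun z : V => z + h *: v) id.
  rewrite (_ : (fun z => _) = id + cst (h *: v)) //.
  by apply: is_diff_eq; rewrite addr0.
have dF (s : R) : 0 <= s <= h ->
    is_diff (x + s *: u) F
      (fun w => 'd f (x + s *: u + h *: v) w - 'd f (x + s *: u) w).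
  move=> sh; have [d1 _] := df s h sh hhh; have [d2 _] := df s 0 sh h00.
  rewrite scale0r addr0 in d2.
  have {}d1 := differentiableP d1; have {}d2 := differentiableP d2.
  have d3 : is_diff (x + s *: u) (f \o (fun z => z + h *: v))
    ('d f (x + s *: u + h *: v) \o id) by apply: is_diff_comp.
  exact: is_diffB d3 d2.
have [s sh] := @MVT_line V F x u h h0
  (fun s sh => @ex_diff _ _ _ _ _ _ _ (dF s sh)).
rewrite deriveE; last exact: (@ex_diff _ _ _ _ _ _ _ (dF s sh)).
have [d1 _] := df s h sh hhh; have [d2 _] := df s 0 sh h00.
rewrite scale0r addr0 in d2.
rewrite (@diff_val _ _ _ _ _ _ _ (dF s sh)) {1 2}/F => ->.
rewrite -!deriveE //.
have [t th ->] := @MVT_line V ('D_u f) (x + s *: u) v h h0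
  (fun t th => (df s t sh th).2).
by exists s, t.
Qed.

(* Both mixed derivatives equal, at points close to [x], the second difference
   of [f] divided by [h ^+ 2].                                              *)
Lemma symmetric_derive V (f : V -> R) (A : set V) (x u v : V) :
  open A -> A x -> smooth_on A f ->
  'D_u ('D_v f) x = 'D_v ('D_u f) x.
Proof.
move=> oA Ax sf.
have df y : A y -> differentiable f y by case: (sf 1%N) => d _; exact: d.
have df1 w y : A y -> differentiable ('D_w f) y.
  by case: (sf 2%N) => _ d; case: (d w) => + _; exact.
have cf w1 w2 : {for x, continuous ('D_w2 ('D_w1 f))}.
  by case: (sf 2%N) => _ /(_ w1)[_ /(_ w2)]; exact.
apply/eqP; rewrite -subr_eq0 -normr_le0; apply/ler_addgt0Pr => e e0.
rewrite add0r.
pose B := A `&` [set y | `|'D_u ('D_v f) x - 'D_u ('D_v f) y| < e / 2]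
            `&` [set y | `|'D_v ('D_u f) x - 'D_v ('D_u f) y| < e / 2].
have e2 : 0 < e / 2 by rewrite divr_gt0.
have nB : nbhs x B.
  do ?[apply: filterI].
  - exact: open_nbhs_nbhs.
  - by have /cvgrPdist_lt/(_ _ e2) := cf v u.
  - by have /cvgrPdist_lt/(_ _ e2) := cf u v.
have [h h0 hB] : exists2 h : R, 0 < h & forall s t : R, 0 <= s <= h ->
    0 <= t <= h -> B (x + s *: u + t *: v).
  have /nbhs_ballP[r /= r0 rB] := nB.
  have M0 : 0 < `|u| + `|v| + 1 by rewrite ltr_wpDl // addr_ge0.
  (* With this side the whole parallelogram spanned by [h *: u] and [h *: v] at [x] stays within
     distance [r / 2] of [x]; the [+ 1] keeps the denominator positive when [u] and [v] vanish. *)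
  exists (r / 2 / (`|u| + `|v| + 1)); first by rewrite !divr_gt0.
  move=> s t /andP[s0 sh] /andP[t0 th]; apply: rB.
  rewrite -ball_normE /= -addrA opprD addNKr normrN.
  rewrite (le_lt_trans (ler_normD _ _)) // !normrZ !ger0_norm //.
  rewrite (@le_lt_trans _ _ (r / 2)) //;
    last by rewrite ltr_pdivrMr // ltr_pMr // ltr1n.
  have -> : r / 2 = r / 2 / (`|u| + `|v| + 1) * (`|u| + `|v| + 1).
    by rewrite divfK // gt_eqF.
  set k := _ / _; rewrite !mulrDr mulr1 -[leLHS]addr0 !lerD //.
  - exact: ler_wpM2r.
  - exact: ler_wpM2r.
  - exact: le_trans sh.
have [s1 [t1 [s1h t1h E1]]] : exists s t : R, [/\ 0 <= s <= h, 0 <= t <= h &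
    f (x + h *: u + h *: v) - f (x + h *: u) - (f (x + h *: v) - f x)
    = h * (h * 'D_v ('D_u f) (x + s *: u + t *: v))].
  apply: second_difference => // s t sh th.
  by have [[Ay _] _] := hB s t sh th; split; [exact: df|exact: df1].
have [s2 [t2 [s2h t2h E2]]] : exists s t : R, [/\ 0 <= s <= h, 0 <= t <= h &
    f (x + h *: v + h *: u) - f (x + h *: v) - (f (x + h *: u) - f x)
    = h * (h * 'D_u ('D_v f) (x + s *: v + t *: u))].
  apply: second_difference => // s t sh th.
  have [[] ] := hB t s th sh; rewrite addrAC => Ay _ _.
  by split; [exact: df|exact: df1].
(* The second difference is symmetric in [u] and [v], so its two evaluations agree and [h] cancels
   twice. *)
have {E1 E2} E : 'D_v ('D_u f) (x + s1 *: u + t1 *: v) =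
    'D_u ('D_v f) (x + s2 *: v + t2 *: u).
  apply: (mulfI (lt0r_neq0 h0)); apply: (mulfI (lt0r_neq0 h0)).
  apply: (etrans (esym E1)); apply: etrans E2.
  by rewrite (addrAC x (h *: v)) !opprD !opprK addrACA.
have [_ /= B1] := hB _ _ s1h t1h.
have [[_ /=]] := hB _ _ t2h s2h; rewrite (addrAC x) => B2 _.
rewrite (splitr e) -(subrKA ('D_u ('D_v f) (x + s2 *: v + t2 *: u))).
apply: (le_trans (ler_normD _ _)); apply: lerD; first exact: ltW B2.
by rewrite -E distrC; exact: ltW B1.
Qed.
End Differentials.

(** * Change of charts for differentials and tangent vectors *)

Section CompatibleAtlas.
Context {R : realType} {E : normedModType R}.

(* Exactly what makes the chart-wise calculus of [Defs] chart-independent; it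
   holds both for a manifold and for its extended cotangent bundle, which
   carries no topology.                                                      *)
Record compatible_atlas (M : charted E) : Prop := CompatibleAtlas {
  chart_at_atlas : forall p : M, atlas M (chart_at p);
  chart_at_dom : forall p : M, cdom (chart_at p) p;
  cmapK : forall a (p : M), atlas M a -> cdom a p -> cinv a (cmap a p) = p;
  near_chart : forall a b (p : M), atlas M a -> atlas M b ->
    cdom a p -> cdom b p -> \forall x \near cmap a p,
    [/\ cdom a (cinv a x), cdom b (cinv a x) & cmap a (cinv a x) = x];
  transition_differentiable : forall a b (p : M), atlas M a -> atlas M b ->
    cdom a p -> cdom b p -> differentiable (cmap b \o cinv a) (cmap a p) }.

Variables (M : charted E) (cM : compatible_atlas M).
Implicit Types (p : M) (a b c : chart E M).

Lemma near_transition (T : Type) (f : M -> T) a b p :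
  atlas M a -> atlas M b -> cdom a p -> cdom b p ->
  \forall x \near cmap a p, f (cinv b (cmap b (cinv a x))) = f (cinv a x).
Proof.
move=> Aa Ab ap bp; have := near_chart cM Aa Ab ap bp.
by apply: filterS => x [_ bx _]; rewrite (cmapK cM).
Qed.

Lemma diff_cmap_cinv a p : atlas M a -> cdom a p ->
  'd (cmap a \o cinv a) (cmap a p) = id :> (E -> E).
Proof.
move=> Aa ap; rewrite (@near_eq_diff _ _ _ _ id) ?diff_val //.
by have := near_chart cM Aa Aa ap ap; apply: filterS => x [_ _].
Qed.

(** Chain rule: near [cmap a p], the expression of [f] in [a] is its expression in [b] composed with
    the transition map. *)
Lemma diff_change_chart (F : normedModType R) (f : M -> F) a b p (e : E) :
  atlas M a -> atlas M b -> cdom a p -> cdom b p ->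
  differentiable (f \o cinv b) (cmap b p) ->
  'd (f \o cinv a) (cmap a p) e
  = 'd (f \o cinv b) (cmap b p) ('d (cmap b \o cinv a) (cmap a p) e).
Proof.
move=> Aa Ab ap bp df.
have bE : cmap b p = (cmap b \o cinv a) (cmap a p) by rewrite /= (cmapK cM).
have dt := transition_differentiable cM Aa Ab ap bp.
rewrite (@near_eq_diff _ _ _ _ ((f \o cinv b) \o (cmap b \o cinv a))).
- by rewrite diff_comp -?bE.
- have := near_transition f Aa Ab ap bp.
  by apply: filterS => x /= ->.
- by apply: differentiable_comp; rewrite -?bE.
Qed.

Lemma differentiable_change_chart (F : normedModType R) (f : M -> F) a b p :
  atlas M a -> atlas M b -> cdom a p -> cdom b p ->
  differentiable (f \o cinv b) (cmap b p) ->
  differentiable (f \o cinv a) (cmap a p).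
Proof.
move=> Aa Ab ap bp df.
have bE : cmap b p = (cmap b \o cinv a) (cmap a p) by rewrite /= (cmapK cM).
have dt := transition_differentiable cM Aa Ab ap bp.
apply: (@near_eq_differentiable _ _ _ _ ((f \o cinv b) \o (cmap b \o cinv a))).
- have := near_transition f Aa Ab ap bp.
  by apply: filterS => x /= ->.
- by apply: differentiable_comp; rewrite -?bE.
Qed.

(** The two conversions pass through the preferred chart at [p], which the chain rule eliminates.
    The inverse laws below are cases of this cancellation. *)
Lemma vec_to_of_chart a b p (e : E) : atlas M a -> atlas M b ->
  cdom a p -> cdom b p ->
  vec_to_chart b (vec_of_chart a p e) = 'd (cmap b \o cinv a) (cmap a p) e.
Proof.
move=> Aa Ab ap bp; rewrite /vec_to_chart /vec_of_chart.
have [Ac cp] := (chart_at_atlas cM p, chart_at_dom cM p).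
by rewrite -diff_change_chart //; apply: (transition_differentiable cM).
Qed.

Lemma vec_of_chartK a p (e : E) : atlas M a -> cdom a p ->
  vec_to_chart a (vec_of_chart a p e) = e.
Proof. by move=> Aa ap; rewrite vec_to_of_chart // diff_cmap_cinv. Qed.

Lemma vec_to_chartK a p (v : tangent p) : atlas M a -> cdom a p ->
  vec_of_chart a p (vec_to_chart a v) = v.
Proof.
move=> Aa ap; rewrite /vec_to_chart /vec_of_chart.
have [Ac cp] := (chart_at_atlas cM p, chart_at_dom cM p).
rewrite -diff_change_chart //; last exact: (transition_differentiable cM).
by rewrite diff_cmap_cinv.
Qed.

Lemma vec_of_chart_at p (e : E) : vec_of_chart (chart_at p) p e = e.
Proof.
have [Ac cp] := (chart_at_atlas cM p, chart_at_dom cM p).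
by rewrite /vec_of_chart diff_cmap_cinv.
Qed.

Lemma vec_to_chart_at p (v : tangent p) : vec_to_chart (chart_at p) v = v.
Proof.
have [Ac cp] := (chart_at_atlas cM p, chart_at_dom cM p).
by rewrite /vec_to_chart diff_cmap_cinv.
Qed.

Lemma differential_vec_of_chart (f : M -> R) a p (e : E) :
  atlas M a -> cdom a p -> differentiable (f \o cinv a) (cmap a p) ->
  differential f (vec_of_chart a p e) = 'd (f \o cinv a) (cmap a p) e.
Proof.
move=> Aa ap df; rewrite /differential /vec_of_chart.
have [Ac cp] := (chart_at_atlas cM p, chart_at_dom cM p).
by rewrite -diff_change_chart //; exact: differentiable_change_chart df.
Qed.

End CompatibleAtlas.

(** * A smooth manifold has a compatible atlas *)

Section Manifold.
Context {R : realType} {n : nat}.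
Variable Q : smooth_manifold R n.

(** Near [cmap a p], continuity of [cinv a] keeps its values in the open overlap. Openness of the
    image of [a] is used as well: only there is [cinv a] known to be inverted by [cmap a]. *)
Lemma open_chart_overlap (a b : chart _ Q) : atlas Q a -> atlas Q b ->
  open (cmap a @` (cdom a `&` cdom b)).
Proof.
move=> Aa Ab; rewrite openE => _ [p [ap bp] <-].
have cinvp : cinv a (cmap a p) = p by exact: mchartK.
have /(_ (cdom a `&` cdom b)) H := mchart_inv_continuous Aa ap.
have nV : nbhs (cmap a p) (cinv a @^-1` (cdom a `&` cdom b)).
  apply: H; rewrite cinvp; apply: open_nbhs_nbhs; split => //.
  by apply: openI; exact: mchart_open_dom.
have nA : nbhs (cmap a p) (cmap a @` cdom a).
  apply: open_nbhs_nbhs; split; first exact: mchart_open_image.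
  by exists p.
apply: filterS2 nV nA => x [/= ax bx] [q aq qx].
by exists (cinv a x) => //; rewrite -qx mchartK.
Qed.

Lemma manifold_compatible_atlas : compatible_atlas Q.
Proof.
split.
- exact: mchart_at_atlas.
- exact: mchart_at_dom.
- by move=> a p Aa; exact: mchartK.
- move=> a b p Aa Ab ap bp.
  have : nbhs (cmap a p) (cmap a @` (cdom a `&` cdom b)).
    apply: open_nbhs_nbhs; split; first exact: open_chart_overlap.
    by exists p.
  apply: filterS => _ [q [aq bq] <-].
  by rewrite (_ : cinv a (cmap a q) = q) //; exact: mchartK.
- move=> a b p Aa Ab ap bp.
  have [d _] := mchart_transition Aa Ab 1%N.
  by apply: d; exists p.
Qed.

End Manifold.

(** * Projections and matrix entries as maps equal to their own differentials *)

Section ProductProjections.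
Context {R : realType}.
Implicit Types U V W : normedModType R.

Lemma near_fst_fst U V W (x : U * V * W) (P : set U) :
  (\forall y \near x.1.1, P y) -> \forall z \near x, P z.1.1.
Proof.
have : (fun z : U * V * W => z.1.1) @ x --> x.1.1.
  by apply: (@cvg_comp _ _ _ fst fst _ (nbhs x.1)); exact: cvg_fst.
exact.
Qed.

Lemma is_diff_fst_fst U V W (x : U * V * W) :
  is_diff x (fun z : U * V * W => z.1.1) (fun z : U * V * W => z.1.1).
Proof.
have d1 : is_diff x (fst : U * V * W -> U * V) fst.
  by split; [exact: differentiable_fst|exact: diff_fst].
have d2 : is_diff (x.1) (fst : U * V -> U) fst.
  by split; [exact: differentiable_fst|exact: diff_fst].
exact: (@is_diff_comp _ _ _ _ fst fst fst fst).
Qed.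

Lemma is_diff_fst_snd U V W (x : U * V * W) :
  is_diff x (fun z : U * V * W => z.1.2) (fun z : U * V * W => z.1.2).
Proof.
have d1 : is_diff x (fst : U * V * W -> U * V) fst.
  by split; [exact: differentiable_fst|exact: diff_fst].
have d2 : is_diff (x.1) (snd : U * V -> V) snd.
  by split; [exact: differentiable_snd|exact: diff_snd].
exact: (@is_diff_comp _ _ _ _ fst fst snd snd).
Qed.

Lemma is_diff_snd U V (x : U * V) :
  is_diff x (fun z : U * V => z.2) (fun z : U * V => z.2).
Proof. by split; [exact: differentiable_snd|exact: diff_snd]. Qed.

Lemma is_diff_coord m n (M : 'M[R]_(m, n)) i j :
  is_diff M (fun N : 'M[R]_(m, n) => N i j : R) (fun N => N i j).
Proof.
pose f (N : 'M[R]_(m, n)) : R := N i j.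
have lf : linear_for *%R f by move=> k A B; rewrite /f !mxE.
pose L : {linear 'M[R]_(m, n) -> R} :=
  HB.pack f (GRing.isLinear.Build _ _ _ _ _ lf).
have cL : continuous L by exact: coord_continuous.
by split; [exact: differentiable_coord|exact: (diff_lin M cL)].
Qed.

Lemma diff_proj_comp U V W (g : U -> V) (F : W -> U) (x e : W) :
  (forall y, is_diff y g g) -> differentiable F x ->
  'd (g \o F) x e = g ('d F x e).
Proof.
move=> dg dF; have [dgF dgFE] := dg (F x).
exact: etrans (congr1 (@^~ e) (diff_comp dF dgF)) (congr1 (@^~ _) dgFE).
Qed.

End ProductProjections.

(** * Darboux charts form a compatible atlas of the extended cotangent bundle *)

Section Darboux.
Context {R : realType} {n : nat}.
Variable Q : smooth_manifold R n.
Let cQ := manifold_compatible_atlas Q.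
Implicit Types (q : Q) (a b : chart 'rV[R]_n Q).

(** [linfun] accepts any function but returns it faithfully only if it is linear; here linearity
    comes from that of the differential behind [vec_to_chart]. *)
Lemma covector_of_rowE a q (p : 'rV[R]_n) (v : tangent q) :
  (linfun (fun v : 'rV[R]_n =>
     (\sum_i p 0 i * vec_to_chart (p := q) a v 0 i) : R^o) : cotangent q) v
  = \sum_i p 0 i * vec_to_chart a v 0 i.
Proof.
pose f (v : 'rV[R]_n) : R^o := \sum_i p 0 i * vec_to_chart (p := q) a v 0 i.
have lf : linear f.
  move=> k u w; rewrite /f scaler_sumr -big_split /=; apply: eq_bigr => i _.
  by rewrite /vec_to_chart linearP !mxE mulrDr mulrCA.
pose L : {linear 'rV[R]_n -> R^o} :=
  HB.pack f (GRing.isLinear.Build _ _ _ _ _ lf).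
exact: (lfunE L).
Qed.

Lemma cotangentE a q (zeta : cotangent q) (v : tangent q) :
  atlas Q a -> cdom a q ->
  zeta v = \sum_i zeta (vec_of_chart a q (delta_mx 0 i)) * vec_to_chart a v 0 i.
Proof.
move=> Aa aq; rewrite -[in LHS](vec_to_chartK cQ v Aa aq).
rewrite {1}[vec_to_chart a v]row_sum_delta /vec_of_chart !linear_sum /=.
by apply: eq_bigr => i _; rewrite !linearZ /= mulrC.
Qed.

Lemma darboux_cmapK a (u : ext_cotangent Q) : atlas Q a ->
  cdom a (projT1 u.1) -> cinv (darboux_chart a) (cmap (darboux_chart a) u) = u.
Proof.
case: u => -[q zeta] z /= Aa aq; congr (_, _).
set p := \row_i _.
(* The rebuilt base point [cinv a (cmap a q)] is only provably equal to [q], and the type of the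
   covector depends on it; generalising it to [q'] allows the substitution inside the dependent
   pair. *)
suff H q' : q' = q -> existT (@cotangent _ _ Q) q'
    (linfun (fun v : 'rV[R]_n =>
       (\sum_i p 0 i * vec_to_chart (p := q') a v 0 i) : R^o))
    = existT _ q zeta by apply: H; exact: (cmapK cQ).
move=> ->; congr existT; apply/lfunP => v.
rewrite covector_of_rowE (cotangentE zeta v Aa aq).
by apply: eq_bigr => i _; rewrite mxE.
Qed.

Lemma darboux_cinvK a (x : 'rV[R]_n * 'rV[R]_n * R) : atlas Q a ->
  cdom a (cinv a x.1.1) -> cmap a (cinv a x.1.1) = x.1.1 ->
  cmap (darboux_chart a) (cinv (darboux_chart a) x) = x.
Proof.
case: x => -[y p] z /= Aa ay yK; congr (_, _, _) => //.
apply/rowP => i; rewrite mxE covector_of_rowE.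
rewrite (bigD1 i) //= big1 ?addr0 => [|j ji];
  rewrite (vec_of_chartK cQ) // !mxE.
  by rewrite !eqxx mulr1.
by rewrite (negbTE ji) mulr0.
Qed.

(** The momenta transform by the Jacobian of a base transition, so differentiability of a Darboux
    transition requires second-order smoothness on the base. *)
Lemma transition_derive_differentiable a b q (e : 'rV[R]_n) :
  atlas Q a -> atlas Q b -> cdom a q -> cdom b q ->
  differentiable ('D_e (cmap b \o cinv a)) (cmap a q).
Proof.
move=> Aa Ab aq bq; have [_ d] := mchart_transition Aa Ab 2%N.
by have [+ _] := d e; apply; exists q.
Qed.

(** For base coordinates x in [a] and y in [b], the transition is explicit: [base] gives y, the new
    momenta [fib] are the sums over j of p_j dx^j/dy^i, and z is unchanged. Each entry is built from
    differentiable functions by sums and products. *)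
Lemma darboux_transition_differentiable a b (u : ext_cotangent Q) :
  atlas Q a -> atlas Q b -> cdom a (projT1 u.1) -> cdom b (projT1 u.1) ->
  differentiable (cmap (darboux_chart b) \o cinv (darboux_chart a))
    (cmap (darboux_chart a) u).
Proof.
move=> Aa Ab au bu; set x0 := cmap _ u.
pose T := ('rV[R]_n * 'rV[R]_n * R)%type.
pose base (x : T) := (cmap b \o cinv a) x.1.1.
pose D (i : 'I_n) := 'D_(delta_mx 0 i) (cmap a \o cinv b).
pose fib (x : T) := \row_i \sum_j (x.1.2 0 j * D i (base x) 0 j) : 'rV[R]_n.
have dbase : differentiable base x0.
  apply: (@differentiable_comp _ _ _ _ (fun x : T => x.1.1)).
    by case: (is_diff_fst_fst x0).
  exact: (transition_differentiable cQ).
have dD i : differentiable (D i \o base) x0.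
  apply: differentiable_comp => //.
  rewrite /base /= (_ : cinv a _ = projT1 u.1); last exact: (cmapK cQ).
  exact: transition_derive_differentiable.
have dfib : differentiable fib x0.
  apply: differentiable_mx => i j; rewrite ord1 {i}.
  rewrite (_ : (fun x => _) = \sum_k
     ((fun x : T => x.1.2 0 k) * (fun x : T => D j (base x) 0 k))); last first.
    by apply/funext => x; rewrite fct_sumE mxE.
  apply: differentiable_sum => k; apply: differentiableM.
    apply: (@differentiable_comp _ _ _ _ (fun x : T => x.1.2)
      (fun N : 'rV[R]_n => N 0 k : R)).
      by case: (is_diff_fst_snd x0).
    exact: differentiable_coord.
  apply: (@differentiable_comp _ _ _ _ (D j \o base)
    (fun N : 'rV[R]_n => N 0 k : R)) => //.
  exact: differentiable_coord.
(* The closed formula is established only where the base point lies in both chart domains and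
   [cmap a] inverts [cinv a], hence near [x0]. *)
apply: (@near_eq_differentiable _ _ _ _ (fun x : T => (base x, fib x, x.2))).
  have := near_chart cQ Aa Ab au bu.
  move/(@near_fst_fst _ _ _ _ x0); apply: filterS => x [ax bx xK].
  rewrite /=; congr (_, _, _); apply/rowP => i; rewrite !mxE covector_of_rowE.
  apply: eq_bigr => j _; congr (_ * _).
  rewrite (vec_to_of_chart cQ) // /D deriveE //.
  exact: (transition_differentiable cQ).
apply: differentiable_pair; first exact: differentiable_pair.
by case: (is_diff_snd x0).
Qed.

Lemma ext_cotangent_compatible_atlas : compatible_atlas (ext_cotangent Q).
Proof.
split.
- by move=> u; exists (chart_at (projT1 u.1)) => //; exact: (chart_at_atlas cQ).
- by move=> u; exact: (chart_at_dom cQ).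
- by move=> _ u [a Aa <-] au; exact: darboux_cmapK.
- move=> _ _ u [a Aa <-] [b Ab <-] au bu.
  have := near_chart cQ Aa Ab au bu.
  move/(@near_fst_fst _ _ _ _ (cmap (darboux_chart a) u)).
  apply: filterS => x [ax bx xK]; split => //.
  exact: darboux_cinvK.
- by move=> _ _ u [a Aa <-] [b Ab <-]; exact: darboux_transition_differentiable.
Qed.

End Darboux.

(** * Derivatives of row-vector functions: entries, product rule, expansion in a basis *)

Section RowDerivatives.
Context {R : realType}.
Implicit Types V : normedModType R.

Lemma is_derive_coord V n (f : V -> 'rV[R]_n) (x w : V) i :
  differentiable f x ->
  is_derive x w (fun y => f y 0 i : R) ('d f x w 0 i).
Proof.
move=> df; have := @is_diff_comp _ _ _ _ _ _ _ _ x (differentiableP df)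
  (is_diff_coord (f x) 0 i).
move=> dfi; apply: DeriveDef; first exact: diff_derivable.
rewrite deriveE; last by case: dfi.
by rewrite diff_val.
Qed.

Lemma is_derive_dot V n (f g df dg : V -> 'rV[R]_n) (x w : V) :
  is_diff x f df -> is_diff x g dg ->
  is_derive x w (fun y => \sum_i f y 0 i * g y 0 i : R)
    (\sum_i (df w 0 i * g x 0 i + f x 0 i * dg w 0 i)).
Proof.
move=> [fx <-] [gx <-].
rewrite (_ : (fun y => _)
    = \sum_i ((fun y => f y 0 i : R) * (fun y => g y 0 i)));
  last by apply/funext => y; rewrite fct_sumE.
apply: is_derive_sum => i.
have dfi := is_derive_coord w i fx; have dgi := is_derive_coord w i gx.
apply: is_derive_eq.
by rewrite addrC; congr (_ + _); exact: mulrC.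
Qed.

Lemma derive_row_sum V n (f : 'rV[R]_n -> V) (x v : 'rV[R]_n) :
  differentiable f x ->
  'D_v f x = \sum_i v 0 i *: 'D_(delta_mx 0 i) f x.
Proof.
move=> df; rewrite deriveE // {1}[v]row_sum_delta linear_sum.
by apply: eq_bigr => i _; rewrite linearZ /= deriveE.
Qed.

End RowDerivatives.

(** * The contact form in Darboux charts and its Lie derivative *)

Section EvolutionField.
Context {R : realType} {n : nat}.
Variable Q : smooth_manifold R n.
Let cQ := manifold_compatible_atlas Q.
Let cT := ext_cotangent_compatible_atlas Q.
Implicit Types (u : ext_cotangent Q) (a b : chart 'rV[R]_n Q).
Local Notation T := ('rV[R]_n * 'rV[R]_n * R)%type.

(** The preferred chart at [u] is induced by the preferred chart at [pi0 u], so in these two charts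
    [pi0] is the projection to the q-coordinates. *)
Lemma tangent_map_pi0 u (v : tangent u) : tangent_map (@pi0 R n Q) v = v.1.1.
Proof.
rewrite /tangent_map; set x0 : T := cmap _ u.
have ext : \forall x \near x0, (cmap (chart_at (pi0 u)) \o @pi0 R n Q \o
    cinv (chart_at u)) x = x.1.1.
  have Aa := chart_at_atlas cQ (pi0 u); have au := chart_at_dom cQ (pi0 u).
  have := near_chart cQ Aa Aa au au.
  by move/(@near_fst_fst _ _ _ _ x0); apply: filterS => x [_ _].
have [d dE] := is_diff_fst_fst x0.
by rewrite (near_eq_diff ext d) dE.
Qed.

Lemma etaE u (v : tangent u) : eta v = v.2 - projT2 u.1 (v.1.1 : 'rV[R]_n).
Proof.
rewrite /eta /theta tangent_map_pi0 /differential; congr (_ - _).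
set x0 : T := cmap _ u.
by have [_ dE] := is_diff_snd x0; exact: (congr1 (@^~ v) dE).
Qed.

(** The Lie derivative differentiates the coefficients of [eta] in one fixed chart, whereas the
    preferred chart may change with the point. The formula dz - p_i dq^i is therefore needed in
    every induced chart. *)
Lemma eta_in_chart a (x e : T) : atlas Q a -> cdom a (cinv a x.1.1) ->
  cmap a (cinv a x.1.1) = x.1.1 ->
  form_in_chart (@eta R n Q) (darboux_chart a) x e
  = e.2 - \sum_i x.1.2 0 i * e.1.1 0 i.
Proof.
move=> Aa ax xK; rewrite /form_in_chart etaE.
set u : ext_cotangent Q := cinv (darboux_chart a) x.
have ux : cmap (darboux_chart a) u = x by exact: darboux_cinvK.
have [Ab bu] := (chart_at_atlas cQ (pi0 u), chart_at_dom cQ (pi0 u)).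
have dt : differentiable (cmap (chart_at u) \o cinv (darboux_chart a)) x.
  by rewrite -ux; exact: (darboux_transition_differentiable Aa Ab).
rewrite /vec_of_chart ux.
set F := cmap _ \o _ in dt *.
have dba : differentiable (cmap (chart_at (pi0 u)) \o cinv a) x.1.1.
  by rewrite -xK; exact: (transition_differentiable cQ).
(* Darboux transitions do not change z, and act on the q-components as the base transition does
   ([E1]). *)
have E2 : ('d F x e).2 = e.2.
  rewrite -(diff_proj_comp e (@is_diff_snd R _ _) dt).
  by have [_ dE] := is_diff_snd x; exact: (congr1 (@^~ e) dE).
have E1 : ('d F x e).1.1 = vec_of_chart a (pi0 u) e.1.1.
  rewrite -(diff_proj_comp e (@is_diff_fst_fst R _ _ _) dt).
  have [d1 d1E] := is_diff_fst_fst x.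
  rewrite /vec_of_chart xK.
  exact: etrans (congr1 (@^~ e) (diff_comp d1 dba))
    (congr1 _ (congr1 (@^~ e) d1E)).
rewrite E2 E1 covector_of_rowE; congr (_ - _).
by apply: eq_bigr => i _; rewrite (vec_of_chartK cQ).
Qed.

Lemma lie_derivative_eta (X : vector_field (ext_cotangent Q)) u
    (v : tangent u) : smooth_vector_field X ->
  (forall u' : ext_cotangent Q, eta (X u') = 0) ->
  lie_derivative X (@eta R n Q) v
  = \sum_i ((X u).1.1 0 i * v.1.2 0 i - (X u).1.2 0 i * v.1.1 0 i).
Proof.
move=> sX etaX; rewrite /lie_derivative.
have [Ac cp] := (chart_at_atlas cQ (pi0 u), chart_at_dom cQ (pi0 u)).
have Aa := chart_at_atlas cT u.
set c := chart_at (pi0 u) in Ac cp.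
rewrite -[chart_at u]/(darboux_chart c) in Aa *.
set x : T := cmap _ u; set F := vf_in_chart X _.
have uK : cinv (darboux_chart c) x = u by exact: darboux_cmapK.
have Fx : F x = X u.
  rewrite /F /vf_in_chart uK; exact: (vec_to_chart_at cT).
have dF : differentiable F x.
  have [d _] := sX _ Aa 1%N; apply: d; exists u => //; exact: cp.
have nx : \forall y \near x,
    cdom c (cinv c y.1.1) /\ cmap c (cinv c y.1.1) = y.1.1.
  have := near_chart cQ Ac Ac cp cp.
  by move/(@near_fst_fst _ _ _ _ x); apply: filterS => y [].
have etax (e : T) : form_in_chart (@eta R n Q) (darboux_chart c) x e
    = e.2 - \sum_i x.1.2 0 i * e.1.1 0 i.
  by have [cx xK] := nbhs_singleton nx; exact: eta_in_chart.
have d12 := is_diff_fst_snd x.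
have dF11 : is_diff x (fun y => (F y).1.1) (fun e => ('d F x e).1.1).
  exact: is_diff_comp (differentiableP dF) (is_diff_fst_fst (F x)).
have dF2 : differentiable (fun y => (F y).2) x.
  by apply: (@differentiable_comp _ _ _ _ F (fun z : T => z.2)) => //;
    case: (is_diff_snd (F x)).
have dF2E : 'd (fun y => (F y).2) x v = ('d F x v).2.
  exact: (diff_proj_comp v (@is_diff_snd R _ _) dF).
(* With [v] frozen, the value of [eta] varies only through the momenta. *)
have T1 : 'D_(F x) (fun y => form_in_chart (@eta R n Q) (darboux_chart c) y v) x
    = - \sum_i (X u).1.2 0 i * v.1.1 0 i.
  rewrite (@near_eq_derive _ _ _ _
    (cst v.2 - (fun y : T => \sum_i y.1.2 0 i * cst v.1.1 y 0 i))); last first.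
    by apply: filterS nx => y [cy yK]; rewrite eta_in_chart.
  have D := is_derive_dot (F x) d12 (is_diff_cst (v.1.1 : 'rV[R]_n) x).
  rewrite deriveB; [|exact: derivable_cst|exact: (@ex_derive _ _ _ _ _ _ _ D)].
  rewrite derive_cst (@derive_val _ _ _ _ _ _ _ D) sub0r; congr (- _).
  apply: eq_bigr => i _; rewrite Fx -[RHS]addr0; congr (_ + _).
  by rewrite [X in _ * X]mxE mulr0.
have T2 : ('d F x v).2 - \sum_i x.1.2 0 i * ('d F x v).1.1 0 i
    = \sum_i v.1.2 0 i * (X u).1.1 0 i.
  (* The condition on [etaX] holds on a whole neighbourhood of [x], so it may be differentiated
     along [v]; the product rule then trades the derivatives of [F] for [F] itself. *)
  have : 'D_v ((fun y => (F y).2)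
      - (fun y : T => \sum_i y.1.2 0 i * (F y).1.1 0 i)) x = 0.
    rewrite (@near_eq_derive _ _ _ _ (cst 0)) ?derive_cst //.
    apply: filterS nx => y [cy yK].
    apply: etrans (esym (eta_in_chart (F y) Ac cy yK)) _.
    rewrite /form_in_chart /F /vf_in_chart.
    by rewrite (@vec_to_chartK _ _ _ cT _ (cinv (darboux_chart c) y) _ Aa cy).
  have D := is_derive_dot v d12 dF11.
  rewrite deriveB; [|exact: diff_derivable|exact: (@ex_derive _ _ _ _ _ _ _ D)].
  rewrite deriveE // dF2E (@derive_val _ _ _ _ _ _ _ D) => /eqP.
  rewrite subr_eq0 => /eqP ->; rewrite big_split /= addrK.
  by apply: eq_bigr => i _; rewrite Fx.
rewrite T1 etax deriveE // T2 addrC -sumrB.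
by apply: eq_bigr => i _; rewrite [in X in X - _]mulrC.
Qed.

End EvolutionField.

(** * The first prolongation, its tangent map and the Hessian of the generating function *)

Section Prolongation.
Context {R : realType} {n : nat}.
Variables (Q : smooth_manifold R n) (W : Q -> R).
Context (sW : smooth_fun W).
Let cQ := manifold_compatible_atlas Q.
Let cT := ext_cotangent_compatible_atlas Q.
Implicit Types (q : Q) (a : chart 'rV[R]_n Q).
Local Notation T := ('rV[R]_n * 'rV[R]_n * R)%type.

Lemma smooth_fun_differentiable a q : atlas Q a -> cdom a q ->
  differentiable (W \o cinv a) (cmap a q).
Proof. by move=> Aa aq; have [d _] := sW Aa 1%N; apply: d; exists q. Qed.

Lemma smooth_fun_differentiable_derive a q (e : 'rV[R]_n) :
  atlas Q a -> cdom a q ->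
  differentiable ('D_e (W \o cinv a)) (cmap a q).
Proof.
move=> Aa aq; have [_ d] := sW Aa 2%N.
by have [+ _] := d e; apply; exists q.
Qed.

Lemma dW_at_vec_of_chart a q (e : 'rV[R]_n) : atlas Q a -> cdom a q ->
  dW_at W q (vec_of_chart a q e) = 'D_e (W \o cinv a) (cmap a q).
Proof.
move=> Aa aq; have dw := smooth_fun_differentiable Aa aq.
rewrite deriveE // -(differential_vec_of_chart cQ) //.
exact: (lfunE ('d (W \o cinv (chart_at q)) (cmap (chart_at q) q))).
Qed.

Lemma prolongation_in_chart a q : atlas Q a -> cdom a q ->
  cmap (darboux_chart a) (first_prolongation W q)
  = (cmap a q, \row_i 'D_(delta_mx 0 i) (W \o cinv a) (cmap a q), W q).
Proof.
move=> Aa aq; rewrite /=; congr (_, _, _); apply/rowP => i; rewrite !mxE.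
exact: dW_at_vec_of_chart.
Qed.

Lemma is_diff_prolongation q (c := chart_at q) (w := W \o cinv c) :
  is_diff (cmap c q) (cmap (darboux_chart c) \o first_prolongation W \o cinv c)
    (fun v : 'rV[R]_n =>
      (v, \row_i 'D_v ('D_(delta_mx 0 i) w) (cmap c q), 'D_v w (cmap c q))).
Proof.
have [Ac cq] : atlas Q c /\ cdom c q.
  by split; [exact: (chart_at_atlas cQ)|exact: (chart_at_dom cQ)].
set x := cmap c q.
pose dw (y : 'rV[R]_n) : 'rV[R]_n := \row_i 'D_(delta_mx 0 i) w y.
have dwi i : differentiable ('D_(delta_mx 0 i) w) x.
  exact: smooth_fun_differentiable_derive.
have dwx : differentiable w x by exact: smooth_fun_differentiable.
have ddw : differentiable dw x.
  apply: differentiable_mx => i j; rewrite ord1.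
  rewrite (_ : (fun y => _) = 'D_(delta_mx 0 j) w) //.
  by apply/funext => y; rewrite mxE.
have dwE v : 'd dw x v = \row_i 'D_v ('D_(delta_mx 0 i) w) x.
  apply/rowP => i; rewrite mxE.
  have D := is_derive_coord v i ddw.
  rewrite -(@derive_val _ _ _ _ _ _ _ D).
  by congr ('D_v _ x); apply/funext => y; rewrite mxE.
(* At nearby points [dW_at] is defined through preferred charts that may differ from [c];
   [prolongation_in_chart] brings its components back to [c]. *)
have near_x : \forall y \near x,
    (cmap (darboux_chart c) \o first_prolongation W \o cinv c) y
    = (y, dw y, w y).
  have := near_chart cQ Ac Ac cq cq; apply: filterS => y [cy _ yK].
  rewrite -[LHS]/(cmap _ (first_prolongation W (cinv c y))).
  by rewrite prolongation_in_chart // yK.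
have P : is_diff x (fun y => (y, dw y, w y))
    (fun v => (v, 'd dw x v, 'd w x v)).
  have i1 := differentiableP ddw; have i2 := differentiableP dwx.
  exact: is_diff_pair.
have [dP dPE] := P; have [dG dGE] := near_eq_is_diff near_x dP.
split; first exact: dG.
apply: (etrans dGE); apply: (etrans dPE); apply/funext => v.
by congr (_, _, _); [exact: dwE|exact/esym/deriveE].
Qed.

Lemma dW_atE q (v : tangent q) (c := chart_at q) :
  dW_at W q v = 'D_v (W \o cinv c) (cmap c q).
Proof.
rewrite -dW_at_vec_of_chart; first by rewrite (vec_of_chart_at cQ).
- exact: (chart_at_atlas cQ).
- exact: (chart_at_dom cQ).
Qed.

Lemma tangent_map_prolongation q (v : tangent q) (c := chart_at q)
    (w := W \o cinv c) :
  tangent_map (first_prolongation W) v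
  = (v : 'rV[R]_n, \row_i 'D_v ('D_(delta_mx 0 i) w) (cmap c q),
     'D_v w (cmap c q)).
Proof.
by have [_ dE] := is_diff_prolongation q; exact: (congr1 (@^~ v) dE).
Qed.

(** The prolongation is Legendrian: along it z = W and p_i = d_i W, so [eta] pulls back to dW -
    dW. *)
Lemma eta_tangent_map_prolongation q (v : tangent q) :
  eta (tangent_map (first_prolongation W) v) = 0.
Proof. by rewrite etaE tangent_map_prolongation dW_atE subrr. Qed.

(** Chain rule, after inserting the Darboux chart at the prolonged point and its inverse between [H]
    and the prolongation, which changes nothing near [q]. *)
Lemma differential_comp_prolongation (H : ext_cotangent Q -> R) q
    (v : tangent q) : smooth_fun H ->
  differential (H \o first_prolongation W) v
  = differential H (tangent_map (first_prolongation W) v).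
Proof.
move=> sH.
have [Ac cq] := (chart_at_atlas cQ q, chart_at_dom cQ q).
have [dP _] := is_diff_prolongation q.
rewrite /differential /tangent_map.
set c := chart_at q in Ac cq dP *; set x := cmap c q in dP *.
set u := first_prolongation W q.
have PE : (cmap (darboux_chart c) \o first_prolongation W \o cinv c) x
    = cmap (darboux_chart c) u.
  rewrite -[LHS]/(cmap _ (first_prolongation W (cinv c (cmap c q)))).
  by rewrite (cmapK cQ).
have dH : differentiable (H \o cinv (darboux_chart c))
    (cmap (darboux_chart c) u).
  have [d _] := sH _ (chart_at_atlas cT u) 1%N; apply: d.
  by exists u => //; exact: cq.
rewrite (@near_eq_diff _ _ _ _ ((H \o cinv (darboux_chart c)) \o
    (cmap (darboux_chart c) \o first_prolongation W \o cinv c))).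
- rewrite -PE in dH.
  have := congr1 (@^~ v) (diff_comp dP dH); rewrite PE; exact.
- have := near_chart cQ Ac Ac cq cq; apply: filterS => y [cy _ yK].
  apply: (congr1 H); apply: esym.
  exact: (@darboux_cmapK _ _ _ c (first_prolongation W (cinv c y))).
- by apply: (differentiable_comp dP); move: dH; rewrite -PE.
Qed.

(** A matter of coordinates: away from critical points of [W] this bilinear form depends on the
    chart, here the preferred one at [q]. *)
Definition hessian q (u v : 'rV[R]_n) : R :=
  'D_u ('D_v (W \o cinv (chart_at q))) (cmap (chart_at q) q).

Lemma hessianC q u v : hessian q u v = hessian q v u.
Proof.
have Ac := chart_at_atlas cQ q.
apply: (@symmetric_derive _ _ _ (cimage (chart_at q))); last exact: sW.
- exact: mchart_open_image.
- by exists q => //; exact: (chart_at_dom cQ).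
Qed.

Lemma hessian_suml q (u v : 'rV[R]_n) :
  hessian q u v = \sum_i u 0 i * hessian q (delta_mx 0 i) v.
Proof.
apply: derive_row_sum; apply: smooth_fun_differentiable_derive.
- exact: (chart_at_atlas cQ).
- exact: (chart_at_dom cQ).
Qed.

(** Both sides are the Hessian at [u] and [v]. Expansion over the basis is at hand for the first
    argument, and symmetry transports it to the second. *)
Lemma hessian_sum_swap q (u v : 'rV[R]_n) :
  \sum_i u 0 i * hessian q v (delta_mx 0 i)
  = \sum_i v 0 i * hessian q u (delta_mx 0 i).
Proof.
transitivity (hessian q u v).
  by rewrite hessian_suml; apply: eq_bigr => i _; rewrite hessianC.
by rewrite hessianC hessian_suml; apply: eq_bigr => i _; rewrite hessianC.
Qed.

Lemma tangent_map_prolongation_fiber q (v : tangent q) i :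
  (tangent_map (first_prolongation W) v).1.2 0 i
  = hessian q v (delta_mx 0 i).
Proof. by rewrite tangent_map_prolongation mxE. Qed.

Lemma differential_prolongation_evolution (H : ext_cotangent Q -> R)
    (X : vector_field (ext_cotangent Q)) q (v : tangent q)
    (Xq := X (first_prolongation W q) : T) :
  smooth_fun H -> is_evolution_field H X ->
  differential (H \o first_prolongation W) v
  = \sum_i (v : 'rV[R]_n) 0 i
      * (hessian q Xq.1.1 (delta_mx 0 i) - Xq.1.2 0 i).
Proof.
move=> sH [sX LX etaX].
rewrite differential_comp_prolongation //.
have := LX _ (tangent_map (first_prolongation W) v).
(* The Reeb term of the evolution equation disappears on Legendrian directions. *)
rewrite eta_tangent_map_prolongation mulr0 subr0 => <-.
rewrite lie_derivative_eta // sumrB.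
under [RHS]eq_bigr do rewrite mulrBr.
rewrite sumrB -hessian_sum_swap; congr (_ - _); apply: eq_bigr => i _.
  by rewrite tangent_map_prolongation_fiber.
by rewrite tangent_map_prolongation mulrC.
Qed.

(** For the z-component, [eta (X u) = 0] at a prolonged point says that the z-component of [X] is dW
    of its q-components. Only the momenta can then distinguish the two sides of relatedness. *)
Lemma tangent_map_prolongation_reduced (H : ext_cotangent Q -> R)
    (X : vector_field (ext_cotangent Q)) q
    (Xq := X (first_prolongation W q) : T) :
  is_evolution_field H X ->
  tangent_map (first_prolongation W) (reduced_field X W q)
  = (Xq.1.1, \row_i hessian q Xq.1.1 (delta_mx 0 i), Xq.2) :> T.
Proof.
move=> [_ _ /(_ (first_prolongation W q))].
rewrite etaE -/Xq => /eqP; rewrite subr_eq0 => /eqP X2.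
rewrite tangent_map_prolongation /reduced_field tangent_map_pi0 -/Xq.
by congr (_, _, _); rewrite X2; exact/esym/dW_atE.
Qed.

End Prolongation.

Theorem theorem4p4 (R : realType) (n : nat) (Q : smooth_manifold R n)
    (H : ext_cotangent Q -> R) (eps : vector_field (ext_cotangent Q))
    (W : Q -> R) :
  smooth_fun H -> is_evolution_field H eps -> smooth_fun W ->
  related (first_prolongation W) (reduced_field eps W) eps
  <-> (forall (q : Q) (v : tangent q),
         differential (H \o first_prolongation W) v = 0%R).
Proof.
move=> sH Heps sW; split=> [rel q v|dH0 q].
  rewrite (differential_prolongation_evolution sW _ sH Heps) big1 // => i _.
  have := etrans (esym (tangent_map_prolongation_reduced sW q Heps)) (rel q).
  (* The i-th momentum component of relatedness cancels the i-th term of the sum. *)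
  move=> /(congr1 (fun z : 'rV[R]_n * 'rV[R]_n * R => z.1.2 0 i)) /=.
  by rewrite mxE => ->; rewrite subrr mulr0.
apply: (etrans (tangent_map_prolongation_reduced sW q Heps)).
set Xq : 'rV[R]_n * 'rV[R]_n * R := eps _.
suff -> : \row_i hessian W q Xq.1.1 (delta_mx 0 i) = Xq.1.2.
  by case: Xq => -[].
apply/rowP => i; rewrite mxE; apply/eqP; rewrite -subr_eq0; apply/eqP.
(* Testing on the i-th basis vector isolates the i-th momentum defect. *)
have := dH0 q (delta_mx 0 i : 'rV[R]_n).
rewrite (differential_prolongation_evolution sW _ sH Heps) -/Xq.
rewrite (bigD1 i) //= big1 ?addr0 => [|j ji].
  by rewrite mxE !eqxx mul1r.
by rewrite mxE (negbTE ji) andbF mul0r.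
Qed.
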